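(* Let $X$ be a metric space with metric $d$ and let $T:X\to X$ be a continuous map. If the dynamical system $(X,T)$ is Devaney chaotic, then $(X,T)$ is asymptotically sensitive.
   Context: Notation: $B_r(x)$ denotes the open ball of radius $r$ centered at $x\in X$, and $T^n$ denotes the $n$-fold iterate of $T$. Periodic point: a point $x\in X$ is periodic if $T^k(x)=x$ for some integer $k\ge 1$. Sensitive: $(X,T)$ is sensitive if there exists a constant $\delta>0$ such that for all $x\in X$ and all $\epsilon>0$ there are an integer $n>0$ and a pair of points $y,z\in B_\epsilon(x)$ with $d(T^n(z),T^n(y))>\delta$. Devaney chaotic: $(X,T)$ is Devaney chaotic if (i) $T$ is topologically transitive, i.e. for all nonempty open sets $U,V\subseteq X$ there is an integer $n>0$ with $T^n(U)\cap V\neq\emptyset$; (ii) the set of periodic points of $T$ is dense in $X$; and (iii) $(X,T)$ is sensitive. Asymptotically sensitive: $(X,T)$ is asymptotically sensitive if there exists $\delta>0$ such that for all $x\in X$ and all $\epsilon>0$ there are points $y,z\in B_\epsilon(x)$ such that $d(T^{n}(y),T^{n}(z))>\delta$ for infinitely many positive integers $n$. *)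

(* Defs.v *)
From HB Require Import structures.
From mathcomp Require Import all_boot all_order all_algebra.
From mathcomp Require Import boolp classical_sets cardinality reals topology.

Set Implicit Arguments.
Unset Strict Implicit.
Unset Printing Implicit Defensive.

Import Order.TTheory GRing.Theory Num.Theory.

Local Open Scope classical_set_scope.
Local Open Scope ring_scope.

Section dynamics.
Context {R : realType} {X : metricType R}.
Implicit Type T : X -> X.

Definition periodic_point T (x : X) : Prop :=
  exists2 k : nat, (1 <= k)%N & iter k T x = x.

Definition topologically_transitive T : Prop :=
  forall U V : set X, open U -> U !=set0 -> open V -> V !=set0 ->
    exists2 n : nat, (0 < n)%N & (iter n T @` U) `&` V !=set0.

Definition sensitive T : Prop :=
  exists2 delta : R, 0 < delta &
    forall (x : X) (eps : R), 0 < eps ->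
      exists (n : nat) (y z : X),
        [/\ (0 < n)%N, ball x eps y, ball x eps z
          & delta < mdist (iter n T z) (iter n T y)].

Definition devaney_chaotic T : Prop :=
  [/\ topologically_transitive T,
      dense [set x | periodic_point T x]
    & sensitive T].

Definition asymptotically_sensitive T : Prop :=
  exists2 delta : R, 0 < delta &
    forall (x : X) (eps : R), 0 < eps ->
      exists y z : X,
        [/\ ball x eps y, ball x eps z
          & infinite_set [set n : nat |
              (0 < n)%N /\ delta < mdist (iter n T y) (iter n T z)]].

End dynamics.

(* Main.v *)
Require Import Defs.
From mathcomp Require Import all_boot all_order all_algebra.
From mathcomp Require Import boolp classical_sets cardinality reals topology.
From mathcomp Require Import lra.

Import Order.TTheory GRing.Theory Num.Theory.

Local Open Scope classical_set_scope.
Local Open Scope ring_scope.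

(** Sensitivity separates two points [y], [z] of any given ball at some time
    [n], by more than [delta].  Separation at the fixed time [n] is an open
    condition on [(y, z)] because [T^n] is continuous, so by density the two
    points can be replaced by periodic points [p], [q] of the same ball
    ([dense_approx]).  If [a], [b] are periods of [p], [q], then the pair
    [(T^n p, T^n q)] recurs at all the times [n + k a b] ([iter_period]), so
    the one separation is repeated infinitely often ([infinite_progression]).
    The sensitivity constant is thus itself a constant of asymptotic
    sensitivity. *)

Lemma continuous_iter {X : topologicalType} {T : X -> X} (n : nat) :
  continuous T -> continuous (iter n T).
Proof.
move=> T_cont; elim: n => [|n IHn] x; first exact: cvg_id.
exact: (continuous_comp (IHn x) (T_cont _)).
Qed.

Lemma dense_nbhs {X : topologicalType} {S A : set X} {x : X} :
  dense S -> nbhs x A -> exists2 p, S p & A p.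
Proof.
move=> S_dense xA.
have [|p [Ap Sp]] := S_dense A° _ (open_interior A); first by exists x.
by exists p => //; exact: interior_subset Ap.
Qed.

Lemma nbhs_ball_mem {R : realType} {X : metricType R} {x y : X} {eps : R} :
  ball x eps y -> nbhs y (ball x eps).
Proof.
rewrite ballEmdist /= => xy.
have gap : 0 < eps - mdist x y by rewrite subr_gt0.
apply: filterS (nbhsx_ballx y _ gap) => z; rewrite !ballEmdist /= => yz.
by have := metric_triangle x y z; lra.
Qed.

(** Both requirements on the approximant hold on a neighbourhood of [y]. *)
Lemma dense_approx {R : realType} {X : metricType R} {f : X -> X} {S : set X}
    {x y : X} {eps r : R} :
  continuous f -> dense S -> ball x eps y -> 0 < r ->
  exists p, [/\ S p, ball x eps p & mdist (f y) (f p) < r].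
Proof.
move=> f_cont S_dense xy r_gt0.
have fy : nbhs y (f @^-1` ball (f y) r).
  by apply: f_cont; exact: nbhsx_ballx.
have [p Sp [xp /= fp]] := dense_nbhs S_dense (filterI (nbhs_ball_mem xy) fy).
by exists p; split=> //; rewrite ballEmdist in fp.
Qed.

Lemma iter_period {X : Type} {T : X -> X} {p : X} {a : nat} (n k : nat) :
  iter a T p = p -> iter (n + k * a)%N T p = iter n T p.
Proof. by move=> Tp; rewrite iterD iterM (iter_fix k Tp). Qed.

Lemma infinite_progression {A : set nat} {n m : nat} :
  (0 < m)%N -> (forall k, A (n + k * m)%N) -> infinite_set A.
Proof.
move=> m_gt0 A_prog A_fin; apply: infinite_nat.
have -> : [set: nat] = (fun k => n + k * m)%N @^-1` A.
  by apply/seteqP; split=> k // _; exact: A_prog.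
apply: finite_preimage A_fin => k l _ _ /addnI/eqP.
by rewrite eqn_pmul2r // => /eqP.
Qed.

Theorem mainTheorem2 (R : realType) (X : metricType R) (T : X -> X)
    (T_cont : continuous T) (T_chaotic : devaney_chaotic T) :
  asymptotically_sensitive T.
Proof.
have [_ per_dense [delta delta_gt0 T_sens]] := T_chaotic.
exists delta => // x eps eps_gt0.
have [n [y [z [n_gt0 xy xz yz]]]] := T_sens x eps eps_gt0.
(* Moving each of the two points by less than half of the excess over delta
   keeps them more than delta apart. *)
pose r := (mdist (iter n T z) (iter n T y) - delta) / 2.
have r_gt0 : 0 < r by rewrite /r; lra.
have Tn_cont := continuous_iter n T_cont.
have [p [[a a_gt0 Tap] xp yp]] := dense_approx Tn_cont per_dense xy r_gt0.
have [q [[b b_gt0 Tbq] xq zq]] := dense_approx Tn_cont per_dense xz r_gt0.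
have pq : delta < mdist (iter n T p) (iter n T q).
  have := metric_triangle (iter n T z) (iter n T q) (iter n T y).
  have := metric_triangle (iter n T q) (iter n T p) (iter n T y).
  rewrite (metric_sym (iter n T q) (iter n T p)).
  rewrite (metric_sym (iter n T p) (iter n T y)).
  by move: yp zq; rewrite /r; lra.
exists p, q; split=> //.
have ab_gt0 : (0 < a * b)%N by rewrite muln_gt0 a_gt0.
apply: (@infinite_progression _ n _ ab_gt0) => k; split.
  by rewrite addn_gt0 n_gt0.
have -> : iter (n + k * (a * b))%N T p = iter n T p.
  by rewrite mulnCA mulnC iter_period.
by rewrite mulnA iter_period.
Qed.
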